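(* Let $R$ be a binary relation on a set $A$ such that (i) $R$ is decidable: for all $x,y$, $R\,y\,x$ or $\lnot R\,y\,x$; (ii) $R$ is finitely branching: for every $x$ there is a finite list containing every $y$ with $R\,y\,x$; (iii) accessibility is weakly decidable: for every $x$, $\lnot(x$ accessible$)$ or $\lnot\lnot(x$ accessible$)$. Then accessibility is coreductive: for every $x$ that is not accessible there exists $y$ with $R\,y\,x$ and $y$ not accessible.
   Context: Work in constructive (intuitionistic) logic / Martin-Löf type theory without excluded middle or other axioms. Let $R$ be a binary relation on $A$ (think of $R\,y\,x$ as a reduction step from $x$ to $y$). Accessibility is defined inductively: $x$ is accessible if every $y$ with $R\,y\,x$ is accessible. *)

(* Defs.v *)
From Stdlib Require Import List.

(* Main.v *)
(* Along the finite list of candidate successors of x, each candidate is either a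
   non-accessible successor (a witness) or, by weak decidability of accessibility,
   "not not" harmless.  A finite conjunction of double negations is the double
   negation of the conjunction, so without a witness all successors of x are
   "not not" accessible, hence x is "not not" accessible, contradicting ~ Acc R x. *)
Require Import Defs.
From Stdlib Require Import List.

Lemma list_ex_or_notnot_all (A : Type) (P Q : A -> Prop) (l : list A) :
  (forall y, In y l -> Q y \/ ~ ~ P y) ->
  (exists y, Q y) \/ ~ ~ (forall y, In y l -> P y).
Proof.
  induction l as [|a l IH]; intros Hl.
  - right; intros H; apply H; intros y [].
  - destruct IH as [Hex | Hnn]; [intros y Hy; apply Hl; right; exact Hy | left; exact Hex |].
    destruct (Hl a (or_introl eq_refl)) as [Qa | Pa]; [left; exists a; exact Qa |].
    right; intros Hnot.
    apply Hnn; intros Hall; apply Pa; intros HPa.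
    apply Hnot; intros y [<- | Hy]; auto.
Qed.

Lemma successor_witness_or_notnot_acc (A : Type) (R : A -> A -> Prop)
  (Hdec : forall x y : A, R y x \/ ~ R y x)
  (Hwd : forall x : A, ~ Acc R x \/ ~ ~ Acc R x) (x y : A) :
  (R y x /\ ~ Acc R y) \/ ~ ~ (R y x -> Acc R y).
Proof.
  destruct (Hdec x y) as [Hyx | Hyx].
  - destruct (Hwd y) as [Hn | Hnn]; [left; split; assumption |].
    right; intros H; apply Hnn; intros Hacc; apply H; intros _; exact Hacc.
  - right; intros H; apply H; intros Hyx'; contradiction.
Qed.

Theorem mainTheorem19 (A : Type) (R : A -> A -> Prop)
  (Hdec : forall x y : A, R y x \/ ~ R y x)
  (Hfin : forall x : A, exists l : list A, forall y : A, R y x -> In y l)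
  (Hwd : forall x : A, ~ Acc R x \/ ~ ~ Acc R x) :
  forall x : A, ~ Acc R x -> exists y : A, R y x /\ ~ Acc R y.
Proof.
  intros x Hx.
  destruct (Hfin x) as [l Hl].
  destruct (list_ex_or_notnot_all A (fun y => R y x -> Acc R y)
              (fun y => R y x /\ ~ Acc R y) l)
    as [Hex | Hnn]; [intros y _; apply successor_witness_or_notnot_acc; assumption
                    | exact Hex |].
  exfalso; apply Hnn; intros Hall.
  apply Hx; constructor; intros y Hyx.
  exact (Hall y (Hl y Hyx) Hyx).
Qed.
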